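(* Let $x_0,y_0>0$, $\Omega=\{(x,y):0<x<x_0,\ 0<y<y_0\}$, $g,q,b,z_d\in\mathbb{R}$, and for $\alpha>0$ let $u,p,u_\alpha,p_\alpha$ be the states and adjoint states defined in the context. Then $u_\alpha$ converges to $u$ and $p_\alpha$ converges to $p$ when $\alpha\to\infty$. Moreover, there exists a positive constant $K_1=K_1(x_0,y_0,g,q)$ such that $$\|u_{\alpha}-u\|_{H^1(\Omega)}=\|u_{\alpha}-u\|_{L^2(\Omega)}= \frac{K_1}{\alpha},\qquad\text{where } K_1=(x_0 y_0)^{1/2}\, |q-gx_0|,$$ and there exists a positive constant $L_1=L_1(x_0,y_0,g,q,b,z_d)$ such that $$\lim_{\alpha\to\infty} \alpha\, \|p_{\alpha}-p\|_{L^2(\Omega)}=L_1,$$ where $$L_1=\left\{\frac{x_0^3 y_0}{180} \Big|180 (b-z_d)^2 + 129 q^2 x_0^2 - 208 g q x_0^3 + 84 g^2 x_0^4 - 60 (b-z_d) (5 q x_0 - 4 g x_0^2 ) \Big|\right\}^{1/2}.$$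
   Context: $\Gamma_1=\{x=0,\ 0\le y\le y_0\}$, $\Gamma_2=\{x=x_0,\ 0\le y\le y_0\}$, $\Gamma_3=\{y=0\text{ or }y=y_0,\ 0<x<x_0\}$; $\partial/\partial n$ is the outward normal derivative. The following are the unique solutions of the respective mixed problems: $u$: $-\Delta u=g$ in $\Omega$, $u|_{\Gamma_1}=b$, $-\frac{\partial u}{\partial n}|_{\Gamma_2}=q$, $\frac{\partial u}{\partial n}|_{\Gamma_3}=0$; $p$: $-\Delta p=u-z_d$ in $\Omega$, $p|_{\Gamma_1}=0$, $\frac{\partial p}{\partial n}|_{\Gamma_2}=0$, $\frac{\partial p}{\partial n}|_{\Gamma_3}=0$; $u_\alpha$: $-\Delta u_\alpha=g$ in $\Omega$, $-\frac{\partial u_\alpha}{\partial n}|_{\Gamma_1}=\alpha(u_\alpha-b)$, $-\frac{\partial u_\alpha}{\partial n}|_{\Gamma_2}=q$, $\frac{\partial u_\alpha}{\partial n}|_{\Gamma_3}=0$; $p_\alpha$: $-\Delta p_\alpha=u_\alpha-z_d$ in $\Omega$, $-\frac{\partial p_\alpha}{\partial n}|_{\Gamma_1}=\alpha p_\alpha$, $\frac{\partial p_\alpha}{\partial n}|_{\Gamma_2}=0$, $\frac{\partial p_\alpha}{\partial n}|_{\Gamma_3}=0$. $\|v\|_{H^1(\Omega)}^2=\|v\|_{L^2(\Omega)}^2+\|\nabla v\|_{L^2(\Omega)}^2$.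
   Formalization: K_1 is 0 when q = g x_0, and L_1 is 0 when moreover b - z_d = g x_0^2/6, so positivity of K_1 and of L_1 is asserted only outside these respective cases; all equalities and limits hold without restriction. *)

(* Defs.v *)
From HB Require Import structures.
From mathcomp Require Import all_boot all_order all_algebra.
From mathcomp Require Import all_classical all_reals all_analysis.

Set Implicit Arguments.
Unset Strict Implicit.
Unset Printing Implicit Defensive.

Import Order.TTheory GRing.Theory Num.Theory.
Import numFieldNormedType.Exports.

Local Open Scope classical_set_scope.
Local Open Scope ring_scope.

Section Rectangle.
Context {R : realType}.
Implicit Types (u v f p : R * R -> R) (z : R * R).

Definition Omega (x0 y0 : R) : set (R * R) := `]0, x0[ `*` `]0, y0[.

Definition Gamma1 (y0 : R) : set (R * R) :=
  [set z | z.1 = 0 /\ 0 <= z.2 <= y0].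

Definition Gamma2 (x0 y0 : R) : set (R * R) :=
  [set z | z.1 = x0 /\ 0 <= z.2 <= y0].

Definition Gamma3 (x0 y0 : R) : set (R * R) :=
  [set z | (z.2 = 0 \/ z.2 = y0) /\ 0 < z.1 < x0].

(* The four corners belong to Gamma1 or Gamma2, where the normal is taken
   horizontal. Only used on the boundary of Omega. *)
Definition outward_normal (x0 : R) z : R * R :=
  if z.1 == 0 then (-1, 0) else
  if z.1 == x0 then (1, 0) else
  if z.2 == 0 then (0, -1) else (0, 1).

(* The outward normal derivative of v at the boundary point z exists and is
   equal to l. The difference quotient is one-sided, so that only the values of
   v on the closed rectangle matter. *)
Definition normal_derivative_is (x0 : R) v z (l : R) : Prop :=
  (v z - v (z - h *: outward_normal x0 z)) / h @[h --> 0^'+] --> l.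

Definition e1 : R * R := (1, 0).
Definition e2 : R * R := (0, 1).

Definition C1_on (A : set (R * R)) v : Prop :=
  forall z, A z -> forall e, e = e1 \/ e = e2 ->
    derivable v z e /\ {for z, continuous ('D_e v)}.

Definition C2_on (A : set (R * R)) v : Prop :=
  C1_on A v /\ forall e, e = e1 \/ e = e2 -> C1_on A ('D_e v).

Definition laplacian v z : R := 'D_e1 ('D_e1 v) z + 'D_e2 ('D_e2 v) z.

(* Classical solutions of - Delta v = f in Omega: C^2 in Omega and continuous up
   to the boundary; v is unconstrained off the closed rectangle. *)
Definition poisson (x0 y0 : R) f v : Prop :=
  [/\ C2_on (Omega x0 y0) v,
      {within closure (Omega x0 y0), continuous v} &
      forall z, Omega x0 y0 z -> - laplacian v z = f z].

Definition is_state (x0 y0 g q b : R) u : Prop :=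
  [/\ poisson x0 y0 (cst g) u,
      forall z, Gamma1 y0 z -> u z = b,
      forall z, Gamma2 x0 y0 z -> normal_derivative_is x0 u z (- q) &
      forall z, Gamma3 x0 y0 z -> normal_derivative_is x0 u z 0].

Definition is_adjoint (x0 y0 zd : R) u p : Prop :=
  [/\ poisson x0 y0 (fun z => u z - zd) p,
      forall z, Gamma1 y0 z -> p z = 0,
      forall z, Gamma2 x0 y0 z -> normal_derivative_is x0 p z 0 &
      forall z, Gamma3 x0 y0 z -> normal_derivative_is x0 p z 0].

Definition is_robin_state (x0 y0 g q b a : R) u : Prop :=
  [/\ poisson x0 y0 (cst g) u,
      forall z, Gamma1 y0 z -> normal_derivative_is x0 u z (- (a * (u z - b))),
      forall z, Gamma2 x0 y0 z -> normal_derivative_is x0 u z (- q) &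
      forall z, Gamma3 x0 y0 z -> normal_derivative_is x0 u z 0].

Definition is_robin_adjoint (x0 y0 zd a : R) u p : Prop :=
  [/\ poisson x0 y0 (fun z => u z - zd) p,
      forall z, Gamma1 y0 z -> normal_derivative_is x0 p z (- (a * p z)),
      forall z, Gamma2 x0 y0 z -> normal_derivative_is x0 p z 0 &
      forall z, Gamma3 x0 y0 z -> normal_derivative_is x0 p z 0].

Local Open Scope ereal_scope.

Definition lebesgue2 := (@lebesgue_measure R \x @lebesgue_measure R).

Definition L2norm (x0 y0 : R) v : \bar R :=
  'N[lebesgue2]_2%:E [EFin \o (v \_ (Omega x0 y0))].

Definition H1norm (x0 y0 : R) v : \bar R :=
  (L2norm x0 y0 v ^+ 2 +
   (L2norm x0 y0 ('D_e1 v) ^+ 2 + L2norm x0 y0 ('D_e2 v) ^+ 2)) `^ 2^-1.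

End Rectangle.

(* Main.v *)
Require Import Defs.
From mathcomp Require Import all_boot all_order all_algebra.
From mathcomp Require Import all_classical all_reals all_analysis.
From mathcomp Require Import measurable_realfun ring lra.

Import Order.TTheory GRing.Theory Num.Theory.
Import numFieldNormedType.Exports.

Local Open Scope classical_set_scope.
Local Open Scope ring_scope.

(** The data are constant on each side of the rectangle, so each of the four
    mixed problems has a solution that is a polynomial in [x] alone, found by
    integrating an ordinary differential equation ([robin_state_poly],
    [robin_adjoint_poly]). Given solutions coincide with these polynomials
    because the mixed problems have at most one classical solution
    ([mixed_problem_unique]). Uniqueness rests on a weak maximum principle
    ([mixed_comparison]), proved by adding a small multiple of a strictly
    subharmonic quadratic barrier whose normal derivative is negative on the
    Neumann sides.

    With [c = g x0 - q], the explicit formulas give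
      [u_a - u = c / a]  and
      [p_a - p = (A + c (x0 x - x^2 / 2)) / a + c x0 / a^2],
    where [A] is the slope of [p] at [x = 0]. The first difference is constant,
    whence the exact value of its norms ([state_difference_norm]). The squared
    norms of the second one are polynomials in [1 / a]
    ([adjoint_difference_norms], by way of [L2norm_poly] and [H1norm_poly]), and
    the leading term yields [L1]: its square is [y0] times the integral over
    [0, x0] of the square of [A + c (x0 x - x^2 / 2)]. This polynomial vanishes
    identically only if [c = 0] and [A = 0], that is, [q = g x0] and
    [b - zd = g x0^2 / 6]. *)

(** * Directional derivatives *)

(** The first derivative enters as a witness valid near [z], so that the
witnesses of two functions combine linearly: second derivatives of sums are obtained
without identifying the first derivative of the sum as a function. *)
Definition second_derivative_is {R : realType} (v : R * R -> R) (z e : R * R)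
    (l : R) : Prop :=
  exists v' : R * R -> R,
    (\forall y \near z, is_derive y e v (v' y)) /\ is_derive z e v' l.

Lemma line_near {R : realType} (z e : R * R) (P : set (R * R)) :
  (\forall y \near z, P y) -> \forall t \near (0 : R), P (z + t *: e).
Proof.
have lineC : {for (0 : R), continuous (fun t : R => z + t *: e)}.
  by apply: continuousD; [exact: cst_continuous | exact: scalel_continuous].
move: lineC; rewrite /prop_for /continuous_at scale0r addr0 => lineC Pz.
by have := lineC _ Pz.
Qed.

(** The two difference quotients are the same function of the increment; this is
how directional derivatives are reduced to derivatives of functions on the
line. *)
Lemma is_derive_line {R : realType} (v : R * R -> R) (z e : R * R) (t l : R) :
  is_derive (z + t *: e) e v l <->
  is_derive t 1 (fun s : R => v (z + s *: e)) l.
Proof.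
pose F := fun h : R => h^-1 *: (v (h *: e + (z + t *: e)) - v (z + t *: e)).
have E : (fun h : R =>
    h^-1 *: (v (z + (h *: (1 : R) + t) *: e) - v (z + t *: e))) = F.
  apply/funext => h; rewrite /F; congr (_ *: (v _ - _)).
  by rewrite scalerDl addrCA -[_ *: 1]/(h * 1) mulr1.
split=> -[dv <-]; split.
- by rewrite /derivable /shift /= E.
- by rewrite /derive /shift /= E.
- by move: dv; rewrite /derivable /shift /= E.
- by rewrite /derive /shift /= E.
Qed.

(** Both the barrier of the maximum principle and, with [Q = 0], the explicit
solutions of the four problems have this form. *)
Definition polysum {R : realType} (P Q : {poly R}) (z : R * R) : R :=
  P.[z.1] + Q.[z.2].

Lemma polysum_continuous {R : realType} (P Q : {poly R}) :
  continuous (polysum P Q : R * R -> R).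
Proof.
move=> z; apply: cvgD; apply: cvg_comp; try exact: continuous_horner.
- exact: cvg_fst.
- exact: cvg_snd.
Qed.

Lemma is_derive_polysum {R : realType} (P Q : {poly R}) (z e : R * R) :
  is_derive z e (polysum P Q)
    (polysum (e.1 *: P^`()) (e.2 *: Q^`()) z).
Proof.
pose S := (P \Po (z.1%:P + e.1 *: 'X)) + (Q \Po (z.2%:P + e.2 *: 'X)).
have -> : polysum (e.1 *: P^`()) (e.2 *: Q^`()) z = (S^`()).[0].
  rewrite /S /polysum !poly.derivE !deriv_comp !poly.derivE.
  rewrite !hornerE !horner_comp !hornerE.
  by rewrite /= !mulr1 [e.1 * _]mulrC [e.2 * _]mulrC.
rewrite -[z in is_derive z]addr0 -[X in z + X](scale0r e).
apply/is_derive_line.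
rewrite (_ : (fun s : R => _) = horner S); first exact: is_derive_poly.
apply/funext => s; rewrite /S /polysum !hornerE !horner_comp !hornerE /=.
by rewrite -[s *: e.1]/(s * e.1) -[s *: e.2]/(s * e.2) ![s * _]mulrC.
Qed.

Lemma second_derivative_polysum {R : realType} (P Q : {poly R}) (z e : R * R) :
  second_derivative_is (polysum P Q) z e
    (e.1 ^+ 2 * P^`()^`().[z.1] + e.2 ^+ 2 * Q^`()^`().[z.2]).
Proof.
exists (polysum (e.1 *: P^`()) (e.2 *: Q^`())); split.
  by near=> y; exact: is_derive_polysum.
have := is_derive_polysum (e.1 *: P^`()) (e.2 *: Q^`()) z e.
by rewrite /polysum !poly.derivE !hornerE.
Unshelve. all: by end_near. Qed.

Lemma second_derivative_lin {R : realType} (v w : R * R -> R) (z e : R * R)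
    (j k l m : R) :
  second_derivative_is v z e l -> second_derivative_is w z e m ->
  second_derivative_is (fun y => j * v y + k * w y) z e (j * l + k * m).
Proof.
move=> [v' [dv dv']] [w' [dw dw']].
exists (fun y => j * v' y + k * w' y); split; last first.
  exact: (is_deriveD (is_deriveZ j dv') (is_deriveZ k dw')).
near=> y.
have dvy : is_derive y e v (v' y) by near: y.
have dwy : is_derive y e w (w' y) by near: y.
exact: (is_deriveD (is_deriveZ j dvy) (is_deriveZ k dwy)).
Unshelve. all: by end_near. Qed.

(** The derivative along the line vanishes at the maximum; were the second
derivative positive, the first one would be positive just after it, and the
mean value theorem would give a larger value. *)
Lemma second_derivative_at_max {R : realType} (v : R * R -> R) (z e : R * R)
    (l : R) :
  second_derivative_is v z e l ->
  (\forall t \near (0 : R), v (z + t *: e) <= v z) -> l <= 0.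
Proof.
move=> [v' [dv dv']] vmax.
pose f (t : R) := v (z + t *: e); pose g (t : R) := v' (z + t *: e).
have df : \forall t \near (0 : R), is_derive (t : R) (1 : R) f (g t).
  by near=> t; apply/is_derive_line; near: t; exact: line_near dv.
have dg : is_derive (0 : R) 1 g l.
  by apply/is_derive_line; rewrite scale0r addr0.
rewrite leNgt; apply/negP => l0.
have [d /= d0 dP] : exists2 d : R, 0 < d &
    forall t, `|t| < d -> is_derive (t : R) (1 : R) f (g t) /\ f t <= f 0.
  have [d /= d0 dP] : \forall t \near (0 : R),
      is_derive (t : R) (1 : R) f (g t) /\ f t <= f 0.
    by near=> t; split; near: t => //; rewrite /f scale0r addr0.
  by exists d => // t td; apply: dP; rewrite /= sub0r normrN.
have itvP (t : R) : t \in `]-d, d[ -> `|t| < d by rewrite in_itv /= ltr_norml.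
have g0 : g 0 = 0.
  have [_ <-] : is_derive (0 : R) 1 f (g 0) by have [] := dP 0; rewrite ?normr0.
  have [||||_ ->] // := @derive1_at_max _ f (- d) d 0.
  - lra.
  - by move=> t /itvP /dP[[]].
  - by rewrite in_itv /=; lra.
  - by move=> t /itvP /dP[].
have [k /= k0 kP] : \forall h \near (0 : R), 0 < h -> 0 < g h.
  have [dg1 dg2] := dg.
  have : h^-1 *: (g (h *: 1 + 0) - g 0) @[h --> (0:R)^'] --> l by rewrite -dg2.
  move=> /cvgr_gt /(_ _ l0) [k /= k0 kP]; exists k => // h hk h0.
  have := kP h hk (lt0r_neq0 h0); rewrite g0 subr0 addr0.
  rewrite -[h *: 1]/(h * 1) mulr1 -[_ *: _]/(_ * _).
  by rewrite pmulr_rgt0 // invr_gt0.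
pose h := Num.min d k / 2.
have h0 : 0 < h by rewrite divr_gt0 // lt_min d0.
have hd : h < d /\ h < k.
  have : Num.min d k <= d /\ Num.min d k <= k by rewrite !ge_min !lexx orbT.
  by rewrite /h in h0 *; lra.
have dfh (t : R) : 0 <= t <= h ->
    is_derive (t : R) (1 : R) f (g t) /\ f t <= f 0.
  by move=> ?; apply: dP; rewrite ltr_norml; lra.
have [||c] := @MVT _ f g 0 h h0.
- by move=> t; rewrite in_itv /= => ?; have /dfh[] : 0 <= t <= h by lra.
- apply: derivable_within_continuous => t; rewrite in_itv /= => ?.
  by have /dfh[[]] : 0 <= t <= h by lra.
rewrite in_itv /= => ch E.
have : 0 < g c by apply: kP; rewrite /= ?sub0r ?normrN ?ltr_norml; lra.
have /dfh[_ fh0] : 0 <= h <= h by lra.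
move: E; rewrite subr0 => E gc.
have := mulr_gt0 gc h0; lra.
Unshelve. all: by end_near. Qed.

(** * One-sided normal derivatives *)

Lemma normal_derivative_lin {R : realType} (x0 : R) (v w : R * R -> R)
    (z : R * R) (j k l m : R) :
  normal_derivative_is x0 v z l -> normal_derivative_is x0 w z m ->
  normal_derivative_is x0 (fun y => j * v y + k * w y) z (j * l + k * m).
Proof.
rewrite /normal_derivative_is => dv dw.
rewrite [X in X @ _ --> _](_ : _ =
    (fun h : R => j * ((v z - v (z - h *: outward_normal x0 z)) / h) +
      k * ((w z - w (z - h *: outward_normal x0 z)) / h))).
  by apply: cvgD; exact: cvgMl_tmp.
by apply/funext => h; ring.
Qed.

(** The change of variable [h -> - h] turns the inward one-sided quotient into
the ordinary one. *)
Lemma normal_derivative_of_derive {R : realType} (x0 : R) (v : R * R -> R)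
    (z : R * R) (l : R) :
  is_derive z (outward_normal x0 z) v l -> normal_derivative_is x0 v z l.
Proof.
move=> [dv <-]; rewrite /normal_derivative_is.
set n := outward_normal x0 z in dv *.
have opp : - h @[h --> (0 : R)^'+] --> (0 : R)^'.
  move=> A [d /= d0 dA]; exists d => //= h hd h0.
  apply: dA; rewrite /= ?oppr_eq0 ?lt0r_neq0 //.
  by move: hd; rewrite /= opprK !sub0r normrN add0r.
rewrite [X in X @ _ --> _](_ : _ =
    (fun h : R => h^-1 *: (v (h *: n + z) - v z)) \o -%R).
  exact: cvg_comp opp dv.
apply/funext => h /=.
rewrite -[(- h)^-1 *: _]/(_ * _) [- h *: n]scaleNr [- (h *: n) + z]addrC invrN.
by rewrite mulNr -mulrN opprB mulrC.
Qed.

Lemma normal_derivative_at_max {R : realType} (x0 : R) (v : R * R -> R)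
    (z : R * R) (l : R) :
  normal_derivative_is x0 v z l ->
  (\forall h \near 0^'+, v (z - h *: outward_normal x0 z) <= v z) -> 0 <= l.
Proof.
move=> dv vmax; rewrite -(cvg_lim _ dv) //.
apply: limr_ge; first by apply: cvgP dv.
near=> h; apply: divr_ge0; last by apply/ltW; near: h; exact: nbhs_right_gt.
by rewrite subr_ge0; near: h.
Unshelve. all: by end_near. Qed.

(** * Maximum principle and uniqueness for the mixed problems *)

Definition closed_rectangle {R : realType} (x0 y0 : R) : set (R * R) :=
  `[0, x0] `*` `[0, y0].

Lemma Omega_sub_closed_rectangle {R : realType} (x0 y0 : R) :
  Omega x0 y0 `<=` closed_rectangle x0 y0.
Proof.
by case=> x y [/=]; rewrite !in_itv /= => ? ?; split; rewrite /= in_itv /=; lra.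
Qed.

Lemma Omega_near {R : realType} (x0 y0 : R) (z : R * R) :
  Omega x0 y0 z -> \forall y \near z, Omega x0 y0 y.
Proof.
case: z => x y [/= xO yO].
exists (`]0, x0[%classic, `]0, y0[%classic) => //; split;
  apply: open_nbhs_nbhs; split => //; exact: interval_open.
Qed.

(** Any point of the closed rectangle is the limit of interior points along the
segment that joins it to the centre. *)
Lemma closed_rectangle_sub_closure {R : realType} (x0 y0 : R) :
  0 < x0 -> 0 < y0 -> closed_rectangle x0 y0 `<=` closure (Omega x0 y0).
Proof.
move=> x0_gt0 y0_gt0 [x y] [/=]; rewrite !in_itv /= => xK yK.
pose path (t : R) : R * R := (x + t * (x0 / 2 - x), y + t * (y0 / 2 - y)).
have pathC : path t @[t --> (0 : R)^'+] --> (x, y).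
  apply: cvg_at_right_filter.
  have P (a b : R) : a + t * b @[t --> (0 : R)] --> a.
    suff : {for (0 : R), continuous (fun t : R => a + t * b)}.
      by rewrite /prop_for /continuous_at mul0r addr0.
    by apply: continuousD; [exact: cst_continuous | exact: mulrr_continuous].
  exact: cvg_pair (P x (x0 / 2 - x)) (P y (y0 / 2 - y)).
move=> B /pathC Bxy.
suff E : \forall t \near (0 : R)^'+, Omega x0 y0 (path t) /\ B (path t).
  have [t ?] := @filter_ex _ _ (at_right_proper_filter (0 : R)) _ E.
  by exists (path t).
near=> t; split; last by near: t.
have t0 : 0 < t by near: t; exact: nbhs_right_gt.
have t1 : t < 1 by near: t; exact: nbhs_right_lt.
by rewrite /Omega /path; split => /=; rewrite in_itv /=; apply/andP; split; nra.
Unshelve. all: by end_near. Qed.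

(** At the corners the normal is horizontal, and moving against it follows the
horizontal side, hence stays in the closed rectangle. *)
Lemma inward_near {R : realType} (x0 y0 : R) (z : R * R) :
  0 < x0 -> 0 < y0 -> closed_rectangle x0 y0 z -> ~ Omega x0 y0 z ->
  \forall h \near 0^'+, closed_rectangle x0 y0 (z - h *: outward_normal x0 z).
Proof.
move=> x0_gt0 y0_gt0; case: z => x y [/=]; rewrite !in_itv /= => xK yK zO.
near=> h.
have h0 : 0 < h by near: h; exact: nbhs_right_gt.
have hx : h < x0 by near: h; exact: nbhs_right_lt.
have hy : h < y0 by near: h; exact: nbhs_right_lt.
rewrite /outward_normal /closed_rectangle /=.
case: eqP => [xE|x_ne0];
  [|case: eqP => [xE|x_nex0]; [|case: eqP => [yE|y_ne0]]];
  rewrite /= !in_itv /= -?[h *: _]/(h * _); try (split; lra).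
have yE : y = y0.
  apply/eqP; apply/negPn/negP => /eqP y_ney0; apply: zO.
  by split; rewrite /= in_itv /= !lt_neqAle; apply/andP; split; apply/andP;
     split; try lra; apply/eqP => //; exact: nesym.
split; lra.
Unshelve. all: by end_near. Qed.

(** Weak maximum principle. Perturb [w] by [e * phi], where
[phi = 2 (x - 2 x0)^2 - (y - y0/2)^2] has Laplacian [4 - 2 > 0] and strictly
negative outward normal derivative on [Gamma2] and [Gamma3], the corners with
their horizontal normal included. The maximum of the perturbed function is then
neither interior nor on [Gamma2] or [Gamma3]. At a maximum on [Gamma1] the
Dirichlet condition gives [w = 0], and the Robin condition gives
[a * w <= e * (8 * x0)], since [8 * x0] is the normal derivative of [phi] there.
Either way [w] is at most a fixed multiple of [e]. *)
Lemma mixed_comparison {R : realType} (x0 y0 a : R) (w : R * R -> R) :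
  0 < x0 -> 0 < y0 -> 0 < a ->
  {within closure (Omega x0 y0), continuous w} ->
  (forall z, Omega x0 y0 z -> exists l m,
     [/\ second_derivative_is w z e1 l, second_derivative_is w z e2 m &
         l + m = 0]) ->
  (forall z, Gamma1 y0 z ->
     w z = 0 \/ normal_derivative_is x0 w z (- (a * w z))) ->
  (forall z, Gamma2 x0 y0 z -> normal_derivative_is x0 w z 0) ->
  (forall z, Gamma3 x0 y0 z -> normal_derivative_is x0 w z 0) ->
  forall z, closed_rectangle x0 y0 z -> w z <= 0.
Proof.
move=> x0_gt0 y0_gt0 a_gt0 wC wO w1 w2 w3 z Kz.
pose P : {poly R} := 2%:P * ('X - (2 * x0)%:P) ^+ 2.
pose Q : {poly R} := - ('X - (y0 / 2)%:P) ^+ 2.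
pose phi := polysum P Q.
have P0E (x : R) : P.[x] = 2 * (x - 2 * x0) ^+ 2 by rewrite /P !hornerE.
have Q0E (y : R) : Q.[y] = - (y - y0 / 2) ^+ 2 by rewrite /Q !hornerE.
have P1E (x : R) : P^`().[x] = 4 * (x - 2 * x0).
  by rewrite /P !poly.derivE !hornerE /=; ring.
have Q1E (y : R) : Q^`().[y] = y0 - 2 * y.
  by rewrite /Q !poly.derivE !hornerE /=; field.
have P2E (x : R) : P^`()^`().[x] = 4.
  by rewrite /P !poly.derivE !hornerE /=; ring.
have Q2E (y : R) : Q^`()^`().[y] = - 2.
  by rewrite /Q !poly.derivE !hornerE /=; ring.
(* On the rectangle phi lies between - y0^2 / 4 and 8 * x0^2, and on Gamma1 w is
   at most 8 * x0 / a times e at the maximum: C bounds the sum. *)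
pose C := 8 * x0 / a + 8 * x0 ^+ 2 + y0 ^+ 2.
have C_gt0 : 0 < C.
  by rewrite !addr_gt0 ?exprn_gt0 ?divr_gt0 ?mulr_gt0.
suff bound (e : R) : 0 < e -> w z <= e * C.
  apply/ler_addgt0Pl => d d_gt0; rewrite addr0.
  by have := bound (d / C); rewrite divfK ?gt_eqF // divr_gt0 //; apply.
move=> e_gt0; pose W := fun y => 1 * w y + e * phi y.
have WC : {within closed_rectangle x0 y0, continuous W}.
  apply: within_continuousD.
    under eq_fun do rewrite mul1r.
    by apply: continuous_subspaceW wC; exact: closed_rectangle_sub_closure.
  apply: continuous_subspaceT => y; apply: cvgMl_tmp.
  exact: polysum_continuous.
have [m mK mMax] : exists2 m, closed_rectangle x0 y0 m &
    forall y, closed_rectangle x0 y0 y -> W y <= W m.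
  have KC : compact (closed_rectangle x0 y0).
    by apply: compact_setX; exact: segment_compact.
  have K0 : closed_rectangle x0 y0 !=set0 by exists z.
  have [m mK mMax] := compact_EVT_max K0 KC WC.
  by exists m => [|y yK]; [exact: set_mem mK | apply: mMax; exact: mem_set].
have Wnormal l : ~ Omega x0 y0 m -> normal_derivative_is x0 w m l ->
    0 <= 1 * l + e * polysum ((outward_normal x0 m).1 *: P^`())
                           ((outward_normal x0 m).2 *: Q^`()) m.
  move=> mO dw; apply: (@normal_derivative_at_max _ x0 W m).
    apply: normal_derivative_lin dw _; apply: normal_derivative_of_derive.
    exact: is_derive_polysum.
  by near=> h; apply: mMax; near: h; exact: inward_near.
have Wle : w m <= 8 * x0 * e / a -> w z <= e * C.
  have := mMax z Kz; move: mK Kz; rewrite /W /phi /polysum !P0E !Q0E /C.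
  case: z => x y; case: m {mMax Wnormal} => x' y' /=.
  move=> [/=]; rewrite !in_itv /= => Kx' Ky' [/=]; rewrite !in_itv /=.
  move=> Kx Ky; rewrite !mul1r => le_Wm le_wm.
  have : e * (2 * (x' - 2 * x0) ^+ 2 + - (y' - y0 / 2) ^+ 2)
      <= e * (8 * x0 ^+ 2).
    have : 0 <= x' * (4 * x0 - x') by apply: mulr_ge0; lra.
    have := sqr_ge0 (y' - y0 / 2).
    by rewrite ler_pM2l // !expr2; lra.
  have : e * (- (y0 ^+ 2)) <= e * (2 * (x - 2 * x0) ^+ 2 + - (y - y0 / 2) ^+ 2).
    have : 0 <= y * (y0 - y) by apply: mulr_ge0; lra.
    have := sqr_ge0 (x - 2 * x0); have := sqr_ge0 y0.
    by rewrite ler_pM2l // !expr2; lra.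
  suff : e * (8 * x0 / a) = 8 * x0 * e / a by lra.
  by rewrite mulrA; congr (_ / _); ring.
have [mO|mO] := pselect (Omega x0 y0 m).
  have [l1 [l2 [dw1 dw2 l12]]] := wO m mO.
  have near_max (d : R * R) : \forall t \near (0 : R), W (m + t *: d) <= W m.
    near=> t; apply: mMax; near: t; apply: line_near.
    by near=> y; apply: Omega_sub_closed_rectangle; near: y; exact: Omega_near.
  have := second_derivative_at_max _ _ _ _
    (second_derivative_lin _ _ _ _ 1 e _ _
      dw1 (second_derivative_polysum P Q m e1)) (near_max e1).
  have := second_derivative_at_max _ _ _ _
    (second_derivative_lin _ _ _ _ 1 e _ _
      dw2 (second_derivative_polysum P Q m e2)) (near_max e2).
  by rewrite /= P2E Q2E; lra.
have {}Wnormal := Wnormal _ mO.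
case: m => mx my in mK mMax Wnormal Wle mO *.
have [/= Kmx Kmy] := mK; move: Kmx Kmy; rewrite !in_itv /= => Kmx Kmy.
have [mx0|mx_ne0] := eqVneq mx 0.
  subst mx.
  have /w1[w0|/Wnormal] : Gamma1 y0 (0, my) by [].
    apply: Wle; rewrite w0; apply: divr_ge0; last exact: ltW.
    by rewrite !mulr_ge0 // ltW.
  rewrite /outward_normal /polysum /= eqxx /= !hornerE P1E /= => h.
  by apply: Wle; rewrite ler_pdivlMr //; lra.
have [mx1|mx_ne1] := eqVneq mx x0.
  have /w2/Wnormal : Gamma2 x0 y0 (mx, my) by [].
  rewrite /outward_normal /polysum /= (negPf mx_ne0) mx1 eqxx /=.
  rewrite !hornerE P1E /=.
  by have := mulr_gt0 e_gt0 x0_gt0; lra.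
have mxO : 0 < mx < x0 by rewrite !lt_neqAle eq_sym mx_ne0 mx_ne1.
have my01 : my = 0 \/ my = y0.
  have [->|my_ne0] := eqVneq my 0; first by left.
  have [->|my_ne1] := eqVneq my y0; first by right.
  case: mO; split; rewrite /= in_itv //=.
  by rewrite !lt_neqAle eq_sym my_ne0 my_ne1.
have /w3/Wnormal : Gamma3 x0 y0 (mx, my) by [].
rewrite /outward_normal /polysum /= (negPf mx_ne0) (negPf mx_ne1).
have ey := mulr_gt0 e_gt0 y0_gt0.
case: eqP => [->|my0] /=; rewrite !hornerE Q1E /=; first lra.
by case: my01 => // ->; lra.
Unshelve. all: by end_near. Qed.

Lemma C2_second_derivative {R : realType} (x0 y0 : R) (v : R * R -> R)
    (z e : R * R) :
  C2_on (Omega x0 y0) v -> Omega x0 y0 z -> e = e1 \/ e = e2 ->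
  second_derivative_is v z e ('D_e ('D_e v) z).
Proof.
move=> [vC1 vC2] zO eE; exists ('D_e v); split; last first.
  by apply: derivableP; have [] := vC2 e eE z zO e eE.
near=> y; have yO : Omega x0 y0 y by near: y; exact: Omega_near.
by apply: derivableP; have [] := vC1 y yO e eE.
Unshelve. all: by end_near. Qed.

(** Every multiple [s * (v - P)] of the difference solves the homogeneous
problem and is therefore nonpositive by the comparison principle; take [s = 1]
and [s = - 1]. On [Gamma1] the alternative covers the Dirichlet condition as well as
the Robin condition with coefficient [a]: in the latter, the difference has
normal derivative [- a] times its value. *)
Lemma mixed_problem_unique {R : realType} (x0 y0 a : R) (f v : R * R -> R)
    (P : {poly R}) :
  0 < x0 -> 0 < y0 -> 0 < a ->
  poisson x0 y0 f v ->
  (forall z, Omega x0 y0 z -> - P^`()^`().[z.1] = f z) ->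
  (forall z, Gamma1 y0 z -> v z = P.[0] \/
     normal_derivative_is x0 v z (- (P^`().[0] + a * (v z - P.[0])))) ->
  (forall z, Gamma2 x0 y0 z -> normal_derivative_is x0 v z P^`().[x0]) ->
  (forall z, Gamma3 x0 y0 z -> normal_derivative_is x0 v z 0) ->
  forall z, closed_rectangle x0 y0 z -> v z = P.[z.1].
Proof.
move=> x0_gt0 y0_gt0 a_gt0 [vC2 vC vf] Pf v1 v2 v3 z Kz.
pose phi := polysum P 0.
have phiE y : phi y = P.[y.1] by rewrite /phi /polysum hornerE addr0.
suff main (s : R) : s * v z + - s * phi z <= 0.
  by have := main 1; have := main (- 1); rewrite phiE; lra.
have dphi y :
    normal_derivative_is x0 phi y ((outward_normal x0 y).1 * P^`().[y.1]).
  apply: normal_derivative_of_derive.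
  have := is_derive_polysum P 0 y (outward_normal x0 y).
  by rewrite {2}/polysum linear0 scaler0 !hornerE.
apply: (mixed_comparison x0 y0 a (fun y => s * v y + - s * phi y)) Kz => // {z}.
- apply: within_continuousD.
    by move=> y; apply: cvgMl_tmp; exact: vC.
  apply: continuous_subspaceT => y; apply: cvgMl_tmp.
  exact: polysum_continuous.
- move=> z zO.
  have d1 := second_derivative_lin _ _ _ _ s (- s) _ _
    (C2_second_derivative x0 y0 v z e1 vC2 zO (or_introl erefl))
    (second_derivative_polysum P 0 z e1).
  have d2 := second_derivative_lin _ _ _ _ s (- s) _ _
    (C2_second_derivative x0 y0 v z e2 vC2 zO (or_intror erefl))
    (second_derivative_polysum P 0 z e2).
  eexists; eexists; split; [exact: d1|exact: d2|].
  have := vf z zO; rewrite -Pf // /laplacian !linear0 !hornerE /=.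
  move: ('D_e1 _ z) ('D_e2 _ z) (P^`()^`().[z.1]) => d d' p'' E.
  have -> : d' = p'' - d by rewrite -[p'']opprK -E; ring.
  by ring.
- move=> z z1; have z10 : z.1 = 0 by case: z1.
  have := dphi z; rewrite /outward_normal z10 eqxx /= mulN1r => dz.
  have [vz|dv] := v1 z z1; [left|right].
    by rewrite phiE z10 vz; ring.
  have := normal_derivative_lin _ _ _ _ s (- s) _ _ dv dz.
  congr (normal_derivative_is _ _ _ _).
  by rewrite phiE z10; ring.
- move=> z z2; have z1x : z.1 = x0 by case: z2.
  have := dphi z; rewrite /outward_normal z1x eqxx gt_eqF //= mul1r => dz.
  have := normal_derivative_lin _ _ _ _ s (- s) _ _ (v2 z z2) dz.
  by congr (normal_derivative_is _ _ _ _); ring.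
- move=> z z3; have /andP[z10 z1x] : 0 < z.1 < x0 by case: z3.
  have := dphi z; rewrite /outward_normal gt_eqF // lt_eqF //.
  have -> : (if z.2 == 0 then (0, -1) else (0, 1) : R * R).1 = 0 by case: ifP.
  rewrite mul0r => dz.
  have := normal_derivative_lin _ _ _ _ s (- s) _ _ (v3 z z3) dz.
  by congr (normal_derivative_is _ _ _ _); ring.
Unshelve. all: by end_near. Qed.

(** * Norms of functions of the first variable *)

Lemma integral_derivative_poly {R : realType} (F f : {poly R}) (a : R) :
  0 < a -> (forall x, F^`().[x] = f.[x]) ->
  (\int[lebesgue_measure]_(x in `]0%R, a[) (f.[x])%:E)%E = (F.[a] - F.[0])%:E.
Proof.
move=> a0 Ff.
rewrite -(@integral_itv_bndoo _ 0 a _ true false); last first.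
  by apply/measurable_EFinP; exact: measurable_poly.
rewrite (@continuous_FTC2 _ (horner f) (horner F)) //.
- by apply: continuous_subspaceT => x; exact: continuous_horner.
- split; first by move=> x _; exact: derivable_horner.
    by apply: cvg_at_right_filter; exact: continuous_horner.
  by apply: cvg_at_left_filter; exact: continuous_horner.
- by move=> x _; rewrite -derivE Ff.
Qed.

(** By Tonelli the square of the norm is [y0] times the integral of [P^2] over
[0, x0], computed with the antiderivative [F]. *)
Lemma L2norm_poly {R : realType} (x0 y0 : R) (v : R * R -> R) (P F : {poly R}) :
  0 < x0 -> 0 < y0 ->
  (forall z, Omega x0 y0 z -> v z = P.[z.1]) ->
  (forall x, F^`().[x] = P.[x] ^+ 2) ->
  0 <= y0 * (F.[x0] - F.[0]) /\
  L2norm x0 y0 v = (Num.sqrt (y0 * (F.[x0] - F.[0])))%:E.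
Proof.
move=> x0_gt0 y0_gt0 vP FP.
pose A : set R := `]0, x0[%classic; pose B : set R := `]0, y0[%classic.
have mA : measurable A by exact: measurable_itv.
have mB : measurable B by exact: measurable_itv.
pose f (z : R * R) : \bar R := ((P ^+ 2).[z.1] * \1_A z.1 * \1_B z.2)%:E.
have f0 z : (0 <= f z)%E.
  rewrite lee_fin horner_exp; apply: mulr_ge0 => //.
  by apply: mulr_ge0 => //; exact: sqr_ge0.
have mf : measurable_fun setT f.
  apply/measurable_EFinP; apply: measurable_funM; last first.
    apply: measurableT_comp; last exact: measurable_snd.
    exact: measurable_indic.
  apply: measurable_funM.
    apply: measurableT_comp; last exact: measurable_fst.
    exact: measurable_poly.
  apply: measurableT_comp; last exact: measurable_fst.
  exact: measurable_indic.
have muB : lebesgue_measure B = y0%:E.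
  by rewrite /B lebesgue_measure_itv /= lte_fin y0_gt0 oppr0 adde0.
have IB : (\int[lebesgue_measure]_y (\1_B y)%:E = y0%:E)%E.
  by rewrite integral_indic // setIT.
have If : (\int[lebesgue2]_z f z)%E = (y0 * (F.[x0] - F.[0]))%:E.
  rewrite /lebesgue2 fubini_tonelli1 // /fubini_F.
  transitivity (\int[lebesgue_measure]_x
      (y0%:E * (((P ^+ 2).[x])%:E * (\1_A x)%:E)))%E.
    apply: eq_integral => x _.
    under eq_integral do rewrite /f /= EFinM.
    rewrite integralZl //; last first.
      apply/integrableP; split.
        by apply/measurable_EFinP; exact: measurable_indic.
      by under eq_integral do rewrite /= ger0_norm //; rewrite IB ltry.
    by rewrite IB muleC -EFinM.
  rewrite ge0_integralZl //; last first.
  - by rewrite lee_fin ltW.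
  - by move=> x _; rewrite -EFinM lee_fin horner_exp mulr_ge0 // sqr_ge0.
  - apply: emeasurable_funM; apply/measurable_EFinP.
      exact: measurable_poly.
    exact: measurable_indic.
  rewrite EFinM; congr (_ * _)%E.
  rewrite -(integral_derivative_poly F (P ^+ 2)) //; last first.
    by move=> x; rewrite FP horner_exp.
  rewrite [RHS]integral_mkcond; apply: eq_integral => x _.
  by rewrite patchE indicE /A; case: ifP => _; rewrite ?mule1 ?mule0.
have I0 : 0 <= y0 * (F.[x0] - F.[0]).
  by rewrite -lee_fin -If; apply: integral_ge0 => z _.
split => //; rewrite /L2norm unlock.
rewrite (_ : (\int[lebesgue2]_z _)%E = (\int[lebesgue2]_z f z)%E).
  by rewrite If poweR_EFin powR12_sqrt.
apply: eq_integral => z _; rewrite /f /=; congr EFin.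
rewrite powR_mulrn // patchE; have [zO|zO] := boolP (z \in Omega x0 y0).
  rewrite vP; last exact: set_mem.
  have [zA zB] : A z.1 /\ B z.2 := set_mem zO.
  by rewrite !indicE !mem_set // !mulr1 real_normK ?num_real // horner_exp.
rewrite normr0 expr0n /= !indicE.
have [zA|_] := boolP (z.1 \in A); last by rewrite mulr0 mul0r.
have [zB|_] := boolP (z.2 \in B); last by rewrite mulr0.
by move/negP: zO; case; apply/mem_set; split; exact: set_mem.
Qed.

Lemma gradient_poly {R : realType} (x0 y0 : R) (v : R * R -> R)
    (P : {poly R}) (z : R * R) :
  (forall z, Omega x0 y0 z -> v z = P.[z.1]) -> Omega x0 y0 z ->
  'D_e1 v z = P^`().[z.1] /\ 'D_e2 v z = 0.
Proof.
move=> vP zO.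
have vE : \forall y \near z, v y = polysum P 0 y.
  near=> y; rewrite vP; last by near: y; exact: Omega_near.
  by rewrite /polysum hornerE addr0.
have d e := near_eq_derive e vE; rewrite !d.
split; rewrite (@derive_val _ _ _ _ _ _ _ (is_derive_polysum P 0 z _)).
  by rewrite /polysum linear0 scaler0 !hornerE /= ?mul1r.
by rewrite /polysum /= scale0r linear0 scaler0 !hornerE.
Unshelve. all: by end_near. Qed.

Lemma H1norm_poly {R : realType} (x0 y0 : R) (v : R * R -> R)
    (P F G : {poly R}) :
  0 < x0 -> 0 < y0 ->
  (forall z, Omega x0 y0 z -> v z = P.[z.1]) ->
  (forall x, F^`().[x] = P.[x] ^+ 2) ->
  (forall x, G^`().[x] = P^`().[x] ^+ 2) ->
  H1norm x0 y0 v =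
    (Num.sqrt (y0 * (F.[x0] - F.[0]) + y0 * (G.[x0] - G.[0])))%:E.
Proof.
move=> x0_gt0 y0_gt0 vP FP GP.
have [F0 NF] := L2norm_poly x0 y0 v P F x0_gt0 y0_gt0 vP FP.
have [|G0 NG] := L2norm_poly x0 y0 ('D_e1 v) P^`() G x0_gt0 y0_gt0 _ GP.
  by move=> z /(gradient_poly x0 y0 v P z vP)[].
have [||_ N0] := L2norm_poly x0 y0 ('D_e2 v) 0 0 x0_gt0 y0_gt0.
- by move=> z /(gradient_poly x0 y0 v P z vP)[_ ->]; rewrite hornerE.
- by move=> x; rewrite linear0 !hornerE expr0n.
rewrite !horner0 subrr mulr0 sqrtr0 in N0.
rewrite /H1norm NF NG N0 -!EFin_expe -!EFinD poweR_EFin powR12_sqrt.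
  by rewrite !sqr_sqrtr // expr0n addr0.
by rewrite !addr_ge0 // sqr_ge0.
Qed.

(** * Limits at infinity *)

(** The norms under study are square roots of polynomials in [a^-1], so all the
limits reduce to continuity at [0]. *)
Lemma cvg_sqrt_poly_inv {R : realType} (S : {poly R}) (f : R -> \bar R) :
  (forall a, 0 < a -> f a = (Num.sqrt S.[a^-1])%:E) ->
  f a @[a --> +oo] --> (Num.sqrt S.[0])%:E.
Proof.
move=> fE.
have invC : a^-1 @[a --> (+oo : set_system R)] --> (0 : R).
  apply/(gtr0_cvgV0 (f := id)); last exact: cvg_id.
  by near=> a; near: a; exact: nbhs_pinfty_gt.
have C : (Num.sqrt S.[a^-1])%:E @[a --> (+oo : set_system R)] -->
    (Num.sqrt S.[0])%:E.
  apply: cvg_EFin; first by near=> a.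
  have := cvg_comp _ _ invC (continuous_horner (p := S) (x := 0)).
  by move=> /(cvg_comp _ _)/(_ (sqrt_continuous (x := S.[0]))).
apply: cvg_trans C; apply: near_eq_cvg.
by near=> a; rewrite fE //; near: a; exact: nbhs_pinfty_gt.
Unshelve. all: by end_near. Qed.

Lemma cvg0_sqrt_poly_inv {R : realType} (S : {poly R}) (f : R -> \bar R) :
  (forall a, 0 < a -> f a = (Num.sqrt S.[a^-1] / a)%:E) ->
  f a @[a --> +oo] --> 0%E.
Proof.
move=> fE; rewrite -[0%E]/(0%:E) -[X in X%:E]sqrtr0.
have -> : 0 = ('X^2 * S).[0] :> R by rewrite !hornerE expr0n mul0r.
apply: cvg_sqrt_poly_inv => a a_gt0; rewrite fE //; congr EFin.
rewrite !hornerE sqrtrM ?sqr_ge0 // sqrtr_sqr ger0_norm ?invr_ge0 ?ltW //.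
by rewrite mulrC.
Qed.

(** * Explicit states and adjoint states *)

(** In the variable [x], the Robin state with coefficient [s^-1]. At [s = 0] it
is the Dirichlet state, which thus appears as the limit [a = +oo]. *)
Definition robin_state_poly {R : realType} (x0 g q b s : R) : {poly R} :=
  (b + (g * x0 - q) * s)%:P + (g * x0 - q) *: 'X - (g / 2) *: 'X^2.

(** With [d = b - zd], the integral over [0, x0] of the Dirichlet state minus
[zd], that is, the slope at [x = 0] of the Dirichlet adjoint state. *)
Definition adjoint_flux {R : realType} (x0 g q d : R) : R :=
  d * x0 + (g * x0 - q) / 2 * x0 ^+ 2 - g / 6 * x0 ^+ 3.

(** The slope at [x = 0] is [k], and the Robin condition forces the value
[k * s] there. Again [s = a^-1], and [s = 0] is the Dirichlet case. *)
Definition robin_adjoint_poly {R : realType} (x0 g q d s : R) : {poly R} :=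
  let c := g * x0 - q in
  let k := adjoint_flux x0 g q d + c * s * x0 in
  (k * s)%:P + k *: 'X - ((d + c * s) / 2) *: 'X^2 - (c / 6) *: 'X^3
    + (g / 24) *: 'X^4.

Lemma state_value {R : realType} (x0 y0 g q b : R) (u : R * R -> R) :
  0 < x0 -> 0 < y0 -> is_state x0 y0 g q b u ->
  forall z, Omega x0 y0 z -> u z = (robin_state_poly x0 g q b 0).[z.1].
Proof.
move=> x0_gt0 y0_gt0 [uP u1 u2 u3] z zO.
apply: (mixed_problem_unique x0 y0 1 _ _ _ x0_gt0 y0_gt0 ltr01 uP) => //.
- move=> y _; rewrite /robin_state_poly !poly.derivE !hornerE /cst /=.
  by field.
- move=> y /u1 ->; by left; rewrite /robin_state_poly !hornerE /=; ring.
- move=> y /u2; congr (normal_derivative_is _ _ _ _).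
  by rewrite /robin_state_poly !poly.derivE !hornerE /=; field.
- exact: Omega_sub_closed_rectangle.
Qed.

Lemma robin_state_value {R : realType} (x0 y0 g q b a : R) (u : R * R -> R) :
  0 < x0 -> 0 < y0 -> 0 < a -> is_robin_state x0 y0 g q b a u ->
  forall z, Omega x0 y0 z -> u z = (robin_state_poly x0 g q b a^-1).[z.1].
Proof.
move=> x0_gt0 y0_gt0 a_gt0 [uP u1 u2 u3] z zO.
have a_neq0 : a != 0 by rewrite gt_eqF.
apply: (mixed_problem_unique x0 y0 a _ _ _ x0_gt0 y0_gt0 a_gt0 uP) => //.
- move=> y _; rewrite /robin_state_poly !poly.derivE !hornerE /cst /=.
  by field.
- move=> y /u1 dz; right; move: dz; congr (normal_derivative_is _ _ _ _).
  by rewrite /robin_state_poly !poly.derivE !hornerE /=; field.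
- move=> y /u2; congr (normal_derivative_is _ _ _ _).
  by rewrite /robin_state_poly !poly.derivE !hornerE /=; field.
- exact: Omega_sub_closed_rectangle.
Qed.

Lemma adjoint_value {R : realType} (x0 y0 g q b zd : R) (u p : R * R -> R) :
  0 < x0 -> 0 < y0 ->
  (forall z, Omega x0 y0 z -> u z = (robin_state_poly x0 g q b 0).[z.1]) ->
  is_adjoint x0 y0 zd u p ->
  forall z, Omega x0 y0 z ->
    p z = (robin_adjoint_poly x0 g q (b - zd) 0).[z.1].
Proof.
move=> x0_gt0 y0_gt0 uE [pP p1 p2 p3] z zO.
apply: (mixed_problem_unique x0 y0 1 _ _ _ x0_gt0 y0_gt0 ltr01 pP) => //.
- move=> y /uE ->; rewrite /robin_adjoint_poly /robin_state_poly.
  by rewrite !poly.derivE !hornerE /=; field.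
- move=> y /p1 ->; by left; rewrite /robin_adjoint_poly !hornerE /=; ring.
- move=> y /p2; congr (normal_derivative_is _ _ _ _).
  by rewrite /robin_adjoint_poly /adjoint_flux !poly.derivE !hornerE /=; field.
- exact: Omega_sub_closed_rectangle.
Qed.

Lemma robin_adjoint_value {R : realType} (x0 y0 g q b zd a : R)
    (u p : R * R -> R) :
  0 < x0 -> 0 < y0 -> 0 < a ->
  (forall z, Omega x0 y0 z -> u z = (robin_state_poly x0 g q b a^-1).[z.1]) ->
  is_robin_adjoint x0 y0 zd a u p ->
  forall z, Omega x0 y0 z ->
    p z = (robin_adjoint_poly x0 g q (b - zd) a^-1).[z.1].
Proof.
move=> x0_gt0 y0_gt0 a_gt0 uE [pP p1 p2 p3] z zO.
have a_neq0 : a != 0 by rewrite gt_eqF.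
apply: (mixed_problem_unique x0 y0 a _ _ _ x0_gt0 y0_gt0 a_gt0 pP) => //.
- move=> y /uE ->; rewrite /robin_adjoint_poly /robin_state_poly.
  by rewrite !poly.derivE !hornerE /=; field.
- move=> y /p1 dz; right; move: dz; congr (normal_derivative_is _ _ _ _).
  by rewrite /robin_adjoint_poly !poly.derivE !hornerE /=; field.
- move=> y /p2; congr (normal_derivative_is _ _ _ _).
  by rewrite /robin_adjoint_poly /adjoint_flux !poly.derivE !hornerE /=; field.
- exact: Omega_sub_closed_rectangle.
Qed.

(** * Convergence as the Robin coefficient grows *)

(** The difference of the states is the constant [(g * x0 - q) / a]; this is why
its gradient vanishes and the two norms agree. *)
Lemma state_difference_norm {R : realType} (x0 y0 g q b a : R)
    (u ua : R * R -> R) :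
  0 < x0 -> 0 < y0 -> 0 < a ->
  is_state x0 y0 g q b u -> is_robin_state x0 y0 g q b a ua ->
  let K := Num.sqrt (x0 * y0) * `|q - g * x0| in
  H1norm x0 y0 (ua \- u) = (K / a)%:E /\ L2norm x0 y0 (ua \- u) = (K / a)%:E.
Proof.
move=> x0_gt0 y0_gt0 a_gt0 us uas K.
have a_neq0 : a != 0 by rewrite gt_eqF.
pose c := (g * x0 - q) / a.
have dE z : Omega x0 y0 z -> (ua \- u) z = (c%:P : {poly R}).[z.1].
  move=> zO; rewrite /= (state_value x0 y0 g q b u) //.
  rewrite (robin_state_value x0 y0 g q b a ua) //.
  by rewrite /robin_state_poly /c !hornerE /=; ring.
have FE x : ((c ^+ 2) *: 'X : {poly R})^`().[x] = (c%:P : {poly R}).[x] ^+ 2.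
  by rewrite !poly.derivE !hornerE.
have GE x : (0 : {poly R})^`().[x] = (c%:P : {poly R})^`().[x] ^+ 2.
  by rewrite !poly.derivE !hornerE expr0n.
have KE : Num.sqrt (y0 * (c ^+ 2 * x0)) = K / a.
  rewrite (_ : y0 * _ = (x0 * y0) * c ^+ 2); last by ring.
  rewrite sqrtrM ?mulr_ge0 ?ltW // sqrtr_sqr /c normrM normfV.
  by rewrite (gtr0_norm a_gt0) distrC mulrA.
rewrite (H1norm_poly x0 y0 _ _ _ _ x0_gt0 y0_gt0 dE FE GE).
have [_ ->] := L2norm_poly x0 y0 _ _ _ x0_gt0 y0_gt0 dE FE.
by rewrite !hornerE /= oppr0 mulr0 !addr0 KE.
Qed.

(** The difference of the adjoint states is [(B + c * (x0 * x - x^2 / 2)) / a],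
with [B] equal, up to a term of order [1 / a], to the slope of [p] at [x = 0];
[Q / a^2] is the integral of its square, and its derivative is
[c * (x0 - x) / a]. *)
Lemma adjoint_difference_norms {R : realType} (x0 y0 g q b zd a : R)
    (u p ua pa : R * R -> R) :
  0 < x0 -> 0 < y0 -> 0 < a ->
  is_state x0 y0 g q b u -> is_adjoint x0 y0 zd u p ->
  is_robin_state x0 y0 g q b a ua -> is_robin_adjoint x0 y0 zd a ua pa ->
  let c := g * x0 - q in
  let B := adjoint_flux x0 g q (b - zd) + c * x0 / a in
  let Q := B ^+ 2 * x0 + 2 / 3 * B * c * x0 ^+ 3 + 2 / 15 * c ^+ 2 * x0 ^+ 5 in
  L2norm x0 y0 (pa \- p) = (Num.sqrt (y0 * Q) / a)%:E /\
  H1norm x0 y0 (pa \- p) =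
    (Num.sqrt (y0 * Q + y0 * (c ^+ 2 * x0 ^+ 3 / 3)) / a)%:E.
Proof.
move=> x0_gt0 y0_gt0 a_gt0 us pS uas pas c B Q.
have a_neq0 : a != 0 by rewrite gt_eqF.
have uE := state_value x0 y0 g q b u x0_gt0 y0_gt0 us.
have pE := adjoint_value x0 y0 g q b zd u p x0_gt0 y0_gt0 uE pS.
have uaE := robin_state_value x0 y0 g q b a ua x0_gt0 y0_gt0 a_gt0 uas.
have paE :=
  robin_adjoint_value x0 y0 g q b zd a ua pa x0_gt0 y0_gt0 a_gt0 uaE pas.
pose D : {poly R} := a^-1 *: (B%:P + (c * x0) *: 'X - (c / 2) *: 'X^2).
pose F : {poly R} := a^-1 ^+ 2 *: (B ^+ 2 *: 'X + (B * c * x0) *: 'X^2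
  + (((c * x0) ^+ 2 - B * c) / 3) *: 'X^3 - (c ^+ 2 * x0 / 4) *: 'X^4
  + (c ^+ 2 / 20) *: 'X^5).
pose G : {poly R} := (a^-1 ^+ 2 * c ^+ 2) *:
  (x0 ^+ 2 *: 'X - x0 *: 'X^2 + 3^-1 *: 'X^3).
have dE z : Omega x0 y0 z -> (pa \- p) z = D.[z.1].
  move=> zO; rewrite /= pE // paE //.
  by rewrite /robin_adjoint_poly /D /B /c !hornerE /=; field.
have FE x : F^`().[x] = D.[x] ^+ 2.
  by rewrite /F /D !poly.derivE !hornerE /=; field.
have GE x : G^`().[x] = D^`().[x] ^+ 2.
  by rewrite /G /D !poly.derivE !hornerE /=; field.
have scale (r : R) : Num.sqrt (a^-1 ^+ 2 * r) = Num.sqrt r / a.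
  by rewrite sqrtrM ?sqr_ge0 // sqrtr_sqr ger0_norm ?invr_ge0 ?ltW // mulrC.
have [_ ->] := L2norm_poly x0 y0 _ _ _ x0_gt0 y0_gt0 dE FE.
rewrite (H1norm_poly x0 y0 _ _ _ _ x0_gt0 y0_gt0 dE FE GE).
rewrite -!scale; split; congr (Num.sqrt _)%:E.
  by rewrite /F /Q !hornerE /=; field.
by rewrite /F /G /Q !hornerE /=; field.
Qed.

Theorem mainTheorem7 (R : realType) (x0 y0 g q b zd : R)
  (u p : R * R -> R) (ua pa : R -> R * R -> R) :
  0 < x0 -> 0 < y0 ->
  is_state x0 y0 g q b u ->
  is_adjoint x0 y0 zd u p ->
  (forall a, 0 < a -> is_robin_state x0 y0 g q b a (ua a)) ->
  (forall a, 0 < a -> is_robin_adjoint x0 y0 zd a (ua a) (pa a)) ->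
  [/\ H1norm x0 y0 (ua a \- u) @[a --> +oo] --> 0%E,
      H1norm x0 y0 (pa a \- p) @[a --> +oo] --> 0%E,
      exists K1 : R,
        [/\ K1 = Num.sqrt (x0 * y0) * `|q - g * x0|,
            (q != g * x0 -> 0 < K1) &
            forall a, 0 < a ->
              H1norm x0 y0 (ua a \- u) = L2norm x0 y0 (ua a \- u) /\
              L2norm x0 y0 (ua a \- u) = (K1 / a)%:E] &
      exists L1 : R,
        [/\ L1 = Num.sqrt (x0 ^+ 3 * y0 / 180 *
                   `|180 * (b - zd) ^+ 2 + 129 * q ^+ 2 * x0 ^+ 2
                     - 208 * g * q * x0 ^+ 3 + 84 * g ^+ 2 * x0 ^+ 4
                     - 60 * (b - zd) * (5 * q * x0 - 4 * g * x0 ^+ 2)|),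
            ((q != g * x0) || (b - zd != g * x0 ^+ 2 / 6) -> 0 < L1) &
            (a%:E * L2norm x0 y0 (pa a \- p)%R)%E @[a --> +oo] --> L1%:E]].
Proof.
move=> x0_gt0 y0_gt0 us pS uas pas.
have x0_neq0 : x0 != 0 by rewrite gt_eqF.
pose c := g * x0 - q; pose d := b - zd.
pose B : {poly R} := (adjoint_flux x0 g q d)%:P + (c * x0) *: 'X.
pose S : {poly R} := y0 *: (x0 *: B ^+ 2 + (2 / 3 * c * x0 ^+ 3) *: B
  + (2 / 15 * c ^+ 2 * x0 ^+ 5)%:P).
have dstate a (a_gt0 : 0 < a) :=
  state_difference_norm x0 y0 g q b a u (ua a) x0_gt0 y0_gt0 a_gt0 us
    (uas a a_gt0).
have dadjoint a (a_gt0 : 0 < a) :=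
  adjoint_difference_norms x0 y0 g q b zd a u p (ua a) (pa a)
    x0_gt0 y0_gt0 a_gt0 us pS (uas a a_gt0) (pas a a_gt0).
split.
- pose K := Num.sqrt (x0 * y0) * `|q - g * x0|.
  apply: (cvg0_sqrt_poly_inv (K ^+ 2)%:P) => a a_gt0.
  rewrite (dstate a a_gt0).1 !hornerE sqrtr_sqr.
  by rewrite [`|K|]ger0_norm // mulr_ge0 // sqrtr_ge0.
- apply: (cvg0_sqrt_poly_inv (S + (y0 * (c ^+ 2 * x0 ^+ 3 / 3))%:P)) => a a_gt0.
  rewrite (dadjoint a a_gt0).2; congr (Num.sqrt _ / _)%:E.
  by rewrite /S /B !hornerE /= -/c -/d; field; rewrite gt_eqF.
- exists (Num.sqrt (x0 * y0) * `|q - g * x0|); split=> //.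
    by move=> qg; rewrite mulr_gt0 ?sqrtr_gt0 ?mulr_gt0 // normr_gt0 subr_eq0.
  by move=> a a_gt0; have [-> ->] := dstate a a_gt0.
set E := (X in `|X|).
(* Completing the square: E is a positive definite quadratic form in al and be,
   and al = be = 0 is exactly the degenerate case. *)
pose al := d + 2 / 3 * g * x0 ^+ 2 - 5 / 6 * q * x0; pose be := c * x0.
have EE : E = 180 * al ^+ 2 + 4 * be ^+ 2.
  by rewrite /E /al /be /c /d; field.
have E_ge0 : 0 <= E by rewrite EE addr_ge0 // mulr_ge0 // sqr_ge0.
have S0 : S.[0] = x0 ^+ 3 * y0 / 180 * `|E|.
  by rewrite ger0_norm // /S /B !hornerE /= /adjoint_flux /E /c /d; field.
exists (Num.sqrt (x0 ^+ 3 * y0 / 180 * `|E|)); split=> //.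
- move=> nondegenerate; rewrite sqrtr_gt0 mulr_gt0 //.
    by rewrite divr_gt0 // mulr_gt0 // exprn_gt0.
  rewrite normr_gt0; apply/negP => /eqP E0.
  have /eqP : al ^+ 2 = 0 by have := sqr_ge0 al; have := sqr_ge0 be; lra.
  rewrite sqrf_eq0 => /eqP al0.
  have /eqP : be ^+ 2 = 0 by have := sqr_ge0 al; have := sqr_ge0 be; lra.
  rewrite sqrf_eq0 mulf_eq0 (negPf x0_neq0) orbF [c == 0]subr_eq0 => /eqP qE.
  move: nondegenerate; rewrite -qE eqxx /= => /eqP; apply.
  by move: al0; rewrite /al /d -qE; lra.
- rewrite -S0; apply: cvg_sqrt_poly_inv => a a_gt0.
  rewrite (dadjoint a a_gt0).1 -EFinM; congr EFin.
  rewrite mulrCA divff ?mulr1 ?gt_eqF //; congr Num.sqrt.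
  by rewrite /S /B !hornerE /= -/c -/d; field; rewrite gt_eqF.
Qed.
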